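(* Let $\beta(z)=\frac{1-z}{1+z}$. The assignments $$a\longmapsto H,\qquad H(z)=\beta\!\left(\frac{1}{\bigl(1+\sqrt{2}\,a(\beta(z))\bigr)^{2}}\right),$$ $$H\longmapsto a,\qquad a(z)=\frac{1+H(\beta(z))-H(-\beta(z))}{\sqrt{2}\,H(-\beta(z))},$$ define mutually inverse bijections between the set of even all-pass functions $a$ and the set of 0-SYM filters $H$. Moreover, if $H$ is a 0-SYM filter with $H(1)=1$, then there exist a sign $\varepsilon\in\{+1,-1\}$ and a polynomial $A$ such that $$H(z)=\frac{A(z)\bigl(A(z)+\varepsilon\sqrt{2}\,A(-z)\bigr)}{A(z)^{2}+A(-z)^{2}+\varepsilon\sqrt{2}\,A(z)A(-z)},$$ where: - $A$ has even degree $d$; - $A(z)$ is coprime with $A(-z)$; - $A$ equals its reciprocal, i.e. $z^{d}A(z^{-1})=A(z)$; - $A(0)A(1)\neq 0$ and $A(-1)=0$.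
   Context: A 0-SYM filter is a rational function $H(z)$ with real coefficients satisfying $H(z)^2+H(-z)^2=1$ and $H(z)=H(z^{-1})$. An even all-pass function is a rational function $a(z)$ with real coefficients satisfying $a(z)a(z^{-1})=1$ and $a(-z)=a(z)$. The reciprocal of a polynomial $E$ of degree $d$ is $z^{d}E(z^{-1})$. *)

(* Defs.v *)
From HB Require Import structures.
From mathcomp Require Import all_boot all_order all_algebra.
From mathcomp Require Import fraction reals.
Set Implicit Arguments. Unset Strict Implicit. Unset Printing Implicit Defensive.
Import Order.TTheory GRing.Theory Num.Theory.
Local Open Scope ring_scope.

Section RatFun.
Variable R : realType.

Definition ratfun := {fraction {poly R}}.

Definition rf (p : {poly R}) : ratfun := @FracField.tofrac _ p.

Definition zz : ratfun := rf 'X.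

Definition peval (p : {poly R}) (g : ratfun) : ratfun :=
  (map_poly (fun c : R => rf c%:P) p).[g].

(* composition f(g(z)) of rational functions, computed from a representative
   f = n/d; independent of the representative whenever g is non-constant
   (which is the case for every use below). *)
Definition fcomp (f g : ratfun) : ratfun :=
  let r := repr f in peval (frac r).1 g / peval (frac r).2 g.

Definition betaf (w : ratfun) : ratfun := (1 - w) / (1 + w).

Definition beta : ratfun := betaf zz.

Definition rf_value (f : ratfun) (x v : R) : Prop :=
  exists p q : {poly R}, [/\ q.[x] != 0, f = rf p / rf q & p.[x] / q.[x] = v].

Definition zero_sym (H : ratfun) : Prop :=
  H ^+ 2 + (fcomp H (- zz)) ^+ 2 = 1 /\ fcomp H zz^-1 = H.

Definition even_allpass (a : ratfun) : Prop :=
  a * fcomp a zz^-1 = 1 /\ fcomp a (- zz) = a.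

Definition Phi (a : ratfun) : ratfun :=
  betaf (1 / (1 + rf (Num.sqrt 2)%:P * fcomp a beta) ^+ 2).

Definition Psi (H : ratfun) : ratfun :=
  (1 + fcomp H beta - fcomp H (- beta)) /
  (rf (Num.sqrt 2)%:P * fcomp H (- beta)).

Definition reciprocal (E : {poly R}) : ratfun :=
  zz ^+ (size E).-1 * fcomp (rf E) zz^-1.

End RatFun.

(* Main.v *)
(** Composition with z -> -z, z -> 1/z and z -> beta(z) are involutive
    automorphisms S, T, B of R(z), and B conjugates S to T.  With b := B a, an
    even all-pass a becomes a function with b * S b = 1 and T b = b, while H is
    obtained from b by H = b (sqrt 2 + b) / (b^2 + sqrt 2 b + 1), with inverse
    b = (1 + H - S H) / (sqrt 2 * S H).  The bijection is then a computation in
    a field where S is an involution, 2 has a square root and -1 has none (the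
    latter makes the denominator nonzero).

    For the normal form, write b = P / Q in lowest terms.  As S b = 1 / b, the
    denominator Q is c P(-z) with c^2 = 1, which gives the formula with A = P.
    As T b = b, A divides its reversal, so the two are proportional; they agree
    at 1, where A does not vanish because A(-1) = 0 and A is coprime to A(-z).
    Comparing leading and constant terms of A(-z) gives the parity of deg A. *)

Require Import Defs.
From HB Require Import structures.
From mathcomp Require Import all_boot all_order all_algebra.
From mathcomp Require Import fraction reals.
From mathcomp Require Import ring.
Import Order.TTheory GRing.Theory Num.Theory.
Local Open Scope ring_scope.

(** * Identities for the Cayley transform and for quotients in a field *)

Lemma cayleyK (F : fieldType) (x : F) : 2 != 0 :> F -> 1 + x != 0 ->
  (1 - (1 - x) / (1 + x)) / (1 + (1 - x) / (1 + x)) = x.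
Proof. by move=> two0 x0; field; rewrite x0 /= (_ : _ + _ = 2) //; ring. Qed.

Lemma cayleyV (F : fieldType) (x : F) : x != 0 -> 1 + x != 0 ->
  (1 - x^-1) / (1 + x^-1) = - ((1 - x) / (1 + x)).
Proof. by move=> x0 x1; field; rewrite x0 x1. Qed.

Lemma div_sqr1 (F : fieldType) (e x y : F) :
  e ^+ 2 = 1 -> x / (e * y) = e * x / y.
Proof.
move=> e2; have e0 : e != 0 by rewrite -sqrf_eq0 e2 oner_eq0.
have eV : e^-1 = e by rewrite -[LHS]mulr1 -e2 expr2 mulKf.
by rewrite invfM eV mulrA [x * _]mulrC.
Qed.

Lemma eq_scaled_ratio (F : fieldType) (e x y u v : F) :
  e != 0 -> y != 0 -> v != 0 -> e * u / v = e * x / y -> u * y = x * v.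
Proof.
move=> e0 y0 v0; rewrite -!mulrA => /(mulfI e0)/eqP.
by rewrite eqr_div // => /eqP.
Qed.

Lemma mul_exprV_sub (F : fieldType) (x : F) (m n : nat) : x != 0 ->
  (m <= n)%N -> x ^+ n * x^-1 ^+ (n - m) = x ^+ m.
Proof.
by move=> x0 mn; rewrite exprVn -{1}(subnKC mn) exprD mulfK // expf_neq0.
Qed.

Lemma sum_sqr_div_eq0 (F : fieldType) (x y : F) :
  1 + (x / y) ^+ 2 = 0 -> y != 0 -> y ^+ 2 + x ^+ 2 = 0.
Proof.
move=> xy0 y0; have -> : y ^+ 2 + x ^+ 2 = (1 + (x / y) ^+ 2) * y ^+ 2 by field.
by rewrite xy0 mul0r.
Qed.

Lemma algebraic_cayley (F E : fieldType) (f : {rmorphism F -> E}) (x : E) :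
  algebraicOver f x -> algebraicOver f ((1 - x) / (1 + x)).
Proof.
move=> algx; have alg1 : algebraicOver f 1 by exact: algebraic1.
by apply: algebraic_div; [exact: algebraic_sub | exact: algebraic_add].
Qed.

(** * Substitution of transcendental functions in R(z) *)

Section Substitution.
Variable R : realType.
Implicit Types (p q : {poly R}) (f g h : ratfun R) (c : R).

Local Notation cst := (@FracField.tofrac {poly R} \o polyC).

(** This condition keeps every nonzero denominator nonzero after substituting g, so that [fcomp _ g]
    is independent of the representative. *)
Definition transcendental g : Prop := ~ algebraicOver cst g.

Lemma rf_eq0 p : (rf p == 0) = (p == 0).
Proof. exact: tofrac_eq0. Qed.

Lemma rf_neq0 p : p != 0 -> rf p != 0.
Proof. by rewrite rf_eq0. Qed.

Lemma rf_inj : injective (@rf R).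
Proof. by move=> p q /eqP; rewrite /rf tofrac_eq => /eqP. Qed.

Lemma ratfun_repr f : f = rf (frac (repr f)).1 / rf (frac (repr f)).2.
Proof.
rewrite -{1}[f]reprK; case: (repr f) => -[n d] /= d0.
rewrite /rf; unlock FracField.tofrac.
rewrite -[X in _ * X]FracField.pi_inv -[RHS]FracField.pi_mul.
congr (\pi_(_) _)%qT; apply: val_inj.
rewrite /FracField.mulf /FracField.invf /= !numden_Ratio ?oner_eq0 // mulr1 mul1r.
by rewrite /Ratio /insubd insubT.
Qed.

Lemma ratfun_frac f : exists p q, q != 0 /\ f = rf p / rf q.
Proof.
by exists (frac (repr f)).1, (frac (repr f)).2; split;
  [exact: denom_ratioP | exact: ratfun_repr].
Qed.

Lemma ratfun_coprime f :
  exists p q, [/\ coprimep p q, q != 0 & f = rf p / rf q].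
Proof.
have [p [q [q0 ->]]] := ratfun_frac f.
have d0 : gcdp p q != 0 by rewrite gcdp_eq0 (negPf q0) andbF.
exists (p %/ gcdp p q), (q %/ gcdp p q); split.
- by rewrite coprimep_div_gcd // q0 orbT.
- by rewrite dvdp_div_eq0 ?dvdp_gcdr.
rewrite -[in LHS](divpK (dvdp_gcdl p q)) -[in X in _ / X](divpK (dvdp_gcdr p q)).
by rewrite /rf !rmorphM -mulf_div divff ?mulr1 // tofrac_eq0.
Qed.

(** Restates the coefficient map as the composite [cst] of two ring morphisms, so that the morphism
    lemmas on [map_poly] apply. *)
Lemma pevalE p g : peval p g = (map_poly cst p).[g].
Proof. by []. Qed.

Lemma peval_neq0 p g : transcendental g -> p != 0 -> peval p g != 0.
Proof. by move=> trg p0; apply/negP => pg0; apply: trg; exists p. Qed.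

Lemma pevalM p q g : peval (p * q) g = peval p g * peval q g.
Proof. by rewrite !pevalE rmorphM hornerM. Qed.

Lemma pevalB p q g : peval (p - q) g = peval p g - peval q g.
Proof. by rewrite !pevalE rmorphB hornerD hornerN. Qed.

Lemma peval1 g : peval 1 g = 1.
Proof. by rewrite pevalE rmorph1 hornerC. Qed.

Lemma pevalC c g : peval c%:P g = rf c%:P.
Proof. by rewrite pevalE map_polyC hornerC. Qed.

Lemma pevalX g : peval 'X g = g.
Proof. by rewrite pevalE map_polyX hornerX. Qed.

(** Two representatives of a fraction satisfy a cross-multiplied polynomial identity, which
    evaluation at g preserves; transcendence of g then allows dividing back. *)
Lemma fcomp_frac p q g : transcendental g -> q != 0 ->
  fcomp (rf p / rf q) g = peval p g / peval q g.
Proof.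
move=> trg q0; rewrite /fcomp.
set r := repr _; have := ratfun_repr (rf p / rf q); rewrite -/r.
have r0 : (frac r).2 != 0 by exact: denom_ratioP.
move/eqP; rewrite eqr_div ?rf_eq0 // /rf -!rmorphM tofrac_eq => /eqP E.
by apply/eqP; rewrite eqr_div ?peval_neq0 // -!pevalM -E mulrC.
Qed.

Lemma fcomp_rf p g : transcendental g -> fcomp (rf p) g = peval p g.
Proof.
move=> trg; rewrite -[rf p]divr1 -[1](rmorph1 (@FracField.tofrac {poly R})).
by rewrite fcomp_frac ?oner_eq0 // peval1 divr1.
Qed.

Section Morphism.
Variables (g : ratfun R) (trg : transcendental g).

(** Carrying the transcendence proof as an argument gives the morphism structures below a head
    symbol to attach to. *)
Definition subst of transcendental g := fun f => fcomp f g.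

Lemma subst_zmod_morphism : zmod_morphism (subst trg).
Proof.
move=> f1 f2; rewrite /subst.
have [p1 [q1 [q10 ->]]] := ratfun_frac f1.
have [p2 [q2 [q20 ->]]] := ratfun_frac f2.
rewrite -mulNr addf_div ?rf_eq0 // mulNr /rf -!rmorphM -rmorphB -!/(rf _).
rewrite !fcomp_frac ?mulf_neq0 // pevalB !pevalM.
by rewrite -[in RHS]mulNr addf_div ?peval_neq0 // mulNr.
Qed.

Lemma subst_monoid_morphism : monoid_morphism (subst trg).
Proof.
rewrite /subst; split=> [|f1 f2].
  by rewrite -[1](rmorph1 (@FracField.tofrac {poly R})) fcomp_rf // peval1.
have [p1 [q1 [q10 ->]]] := ratfun_frac f1.
have [p2 [q2 [q20 ->]]] := ratfun_frac f2.
rewrite mulf_div /rf -!rmorphM -!/(rf _).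
by rewrite !fcomp_frac ?mulf_neq0 // !pevalM mulf_div.
Qed.

HB.instance Definition _ :=
  GRing.isZmodMorphism.Build (ratfun R) (ratfun R) (subst trg)
    subst_zmod_morphism.
HB.instance Definition _ :=
  GRing.isMonoidMorphism.Build (ratfun R) (ratfun R) (subst trg)
    subst_monoid_morphism.

Lemma substE f : fcomp f g = subst trg f. Proof. by []. Qed.

Lemma subst_cst c : subst trg (rf c%:P) = rf c%:P.
Proof. by rewrite /subst fcomp_rf // pevalC. Qed.

Lemma subst_zz : subst trg (zz R) = g.
Proof. by rewrite /subst fcomp_rf // pevalX. Qed.

Lemma subst_peval p h : subst trg (peval p h) = peval p (subst trg h).
Proof.
rewrite !pevalE -horner_map -map_poly_comp.
by congr (_.[_]); apply: eq_map_poly => c; exact: subst_cst.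
Qed.

Lemma transcendental_subst h :
  transcendental h -> transcendental (subst trg h).
Proof.
move=> trh [p p0]; rewrite /root -pevalE -subst_peval fmorph_eq0.
exact/negP/peval_neq0.
Qed.

(** Substitution of g is a field morphism fixing the constants, hence commutes with evaluating
    numerator and denominator at h. *)
Lemma fcompA f h : transcendental h ->
  fcomp (fcomp f h) g = fcomp f (fcomp h g).
Proof.
move=> trh; have [p [q [q0 ->]]] := ratfun_frac f.
rewrite (fcomp_frac _ _ h trh q0).
rewrite (fcomp_frac _ _ (fcomp h g) (transcendental_subst _ trh) q0).
by rewrite [LHS]substE (fmorph_div (subst trg)) /= !subst_peval.
Qed.

Lemma subst_betaf h : subst trg (betaf h) = betaf (subst trg h).
Proof. by rewrite /betaf fmorph_div rmorphB rmorphD rmorph1. Qed.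

End Morphism.

Lemma peval_rf p q : peval p (rf q) = rf (p \Po q).
Proof. by rewrite /peval /comp_poly /rf -horner_map -map_poly_comp. Qed.

Lemma peval_zz p : peval p (zz R) = rf p.
Proof. by rewrite peval_rf comp_polyXr. Qed.

Lemma transcendental_zz : transcendental (zz R).
Proof.
by move=> [p p0]; rewrite /root -pevalE peval_zz rf_eq0 (negPf p0).
Qed.

Lemma transcendentalN g : transcendental g -> transcendental (- g).
Proof. by move=> trg /algebraic_opp; rewrite opprK. Qed.

Lemma transcendentalV g : transcendental g -> transcendental g^-1.
Proof. by move=> trg /algebraic_inv; rewrite invrK. Qed.

Lemma transcendental_neq0 g : transcendental g -> g != 0.
Proof. by move=> trg; apply/eqP => g0; apply: trg; rewrite g0; exact: algebraic0. Qed.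

Lemma two_neq0 : 2 != 0 :> ratfun R.
Proof.
have -> : 2 = rf 2%:P :> ratfun R by rewrite /rf !rmorph_nat.
by rewrite rf_eq0 polyC_eq0 pnatr_eq0.
Qed.

Lemma betafK f : 1 + f != 0 -> betaf (betaf f) = f.
Proof. exact: cayleyK two_neq0. Qed.

Lemma one_add_transcendental_neq0 g : transcendental g -> 1 + g != 0.
Proof.
move=> trg; rewrite addrC -[1]opprK subr_eq0; apply/eqP => g1.
by apply: trg; rewrite g1; apply: algebraic_opp; exact: algebraic1.
Qed.

(** If beta(g) were algebraic, so would be g = beta(beta(g)). *)
Lemma transcendental_betaf g : transcendental g -> transcendental (betaf g).
Proof.
move=> trg algg; apply: (trg); have := algebraic_cayley _ _ _ _ algg.
by rewrite -/(betaf _) (betafK _ (one_add_transcendental_neq0 _ trg)).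
Qed.

Definition transcendental_negz := transcendentalN _ transcendental_zz.
Definition transcendental_invz := transcendentalV _ transcendental_zz.
Definition transcendental_beta := transcendental_betaf _ transcendental_zz.

Definition sub_negz : {rmorphism ratfun R -> ratfun R} :=
  subst _ transcendental_negz.
Definition sub_invz : {rmorphism ratfun R -> ratfun R} :=
  subst _ transcendental_invz.
Definition sub_beta : {rmorphism ratfun R -> ratfun R} :=
  subst _ transcendental_beta.

Lemma fcomp_zz f : fcomp f (zz R) = f.
Proof.
have [p [q [q0 ->]]] := ratfun_frac f.
by rewrite (fcomp_frac _ _ _ transcendental_zz q0) !peval_zz.
Qed.

Let zz_neq0 : zz R != 0 := transcendental_neq0 _ transcendental_zz.

Let one_add_zz_neq0 : 1 + zz R != 0 :=
  one_add_transcendental_neq0 _ transcendental_zz.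

Lemma fcomp_negzK f : fcomp (fcomp f (- zz R)) (- zz R) = f.
Proof.
rewrite (fcompA _ transcendental_negz _ _ transcendental_negz).
rewrite [fcomp (- _) _](substE _ transcendental_negz) rmorphN /=.
by rewrite subst_zz opprK fcomp_zz.
Qed.

Lemma fcomp_betaK f : fcomp (fcomp f (beta R)) (beta R) = f.
Proof.
rewrite (fcompA _ transcendental_beta _ _ transcendental_beta).
rewrite [fcomp (beta R) _](substE _ transcendental_beta).
by rewrite subst_betaf subst_zz betafK ?fcomp_zz.
Qed.

(** This is beta(-z) = 1/beta(z). *)
Lemma fcomp_beta_negz f :
  fcomp (fcomp f (beta R)) (- zz R) = fcomp (fcomp f (zz R)^-1) (beta R).
Proof.
rewrite (fcompA _ transcendental_negz _ _ transcendental_beta).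
rewrite (fcompA _ transcendental_beta _ _ transcendental_invz).
rewrite [fcomp (beta R) _](substE _ transcendental_negz).
rewrite [fcomp _^-1 _](substE _ transcendental_beta).
rewrite subst_betaf fmorphV /= !subst_zz; congr fcomp.
by rewrite /beta /betaf opprK invf_div.
Qed.

(** This is beta(1/z) = -beta(z). *)
Lemma fcomp_beta_invz f :
  fcomp (fcomp f (beta R)) (zz R)^-1 = fcomp (fcomp f (- zz R)) (beta R).
Proof.
rewrite (fcompA _ transcendental_invz _ _ transcendental_beta).
rewrite (fcompA _ transcendental_beta _ _ transcendental_negz).
rewrite [fcomp (beta R) _](substE _ transcendental_invz).
rewrite [fcomp (- _) _](substE _ transcendental_beta).
rewrite subst_betaf rmorphN /= !subst_zz; congr fcomp.
exact: cayleyV zz_neq0 one_add_zz_neq0.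
Qed.

Lemma fcomp_Nbeta f :
  fcomp f (- beta R) = fcomp (fcomp f (- zz R)) (beta R).
Proof.
rewrite (fcompA _ transcendental_beta _ _ transcendental_negz).
rewrite [fcomp (- _) (beta R)](substE _ transcendental_beta).
by rewrite rmorphN /= subst_zz.
Qed.

Lemma fcomp_invz_negz f :
  fcomp (fcomp f (zz R)^-1) (- zz R) = fcomp (fcomp f (- zz R)) (zz R)^-1.
Proof.
rewrite (fcompA _ transcendental_negz _ _ transcendental_invz).
rewrite (fcompA _ transcendental_invz _ _ transcendental_negz).
rewrite [fcomp _^-1 _](substE _ transcendental_negz).
rewrite [fcomp (- _) _](substE _ transcendental_invz).
by rewrite fmorphV rmorphN /= !subst_zz invrN.
Qed.

(** Otherwise q^2 = -p^2 with q nonzero, and the squares of the two leading coefficients would be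
    real numbers with sum zero. *)
Lemma one_add_sqr_neq0 f : 1 + f ^+ 2 != 0.
Proof.
have [p [q [q0 ->]]] := ratfun_frac f.
apply/eqP => /(sum_sqr_div_eq0 {fraction {poly R}}).
rewrite rf_eq0 => /(_ q0) /eqP.
rewrite /rf -!rmorphXn -rmorphD -/(rf _) rf_eq0 addr_eq0 => /eqP.
move=> /(congr1 lead_coef); rewrite lead_coefN !lead_coef_exp => /eqP.
rewrite -addr_eq0 paddr_eq0 ?sqr_ge0 // !sqrf_eq0 lead_coef_eq0.
by rewrite (negPf q0).
Qed.

End Substitution.

(** * The correspondence in a field with an involution S *)

Section Correspondence.
Variables (F : fieldType) (s : F) (S : {rmorphism F -> F}).
Hypotheses (s2 : s ^+ 2 = 2) (two0 : 2 != 0 :> F).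
Hypothesis sqrN1 : forall x : F, 1 + x ^+ 2 != 0.
Hypotheses (Ss : S s = s) (SK : forall x, S (S x) = x).

Definition filter_of (b : F) : F :=
  (1 - 1 / (1 + s * b) ^+ 2) / (1 + 1 / (1 + s * b) ^+ 2).

Definition allpass_of (H : F) : F := (1 + H - S H) / (s * S H).

Let s0 : s != 0.
Proof. by apply: contraNneq two0 => s0; rewrite -s2 s0 expr0n. Qed.

(** Since s^2 = 2, twice the trinomial is 1 + (1 + s x)^2, and -1 is not a square. *)
Lemma trinomial_neq0 (x : F) : x ^+ 2 + s * x + 1 != 0.
Proof.
rewrite -(mulIr_eq0 _ (mulIf two0)).
by rewrite (_ : _ * 2 = 1 + (1 + s * x) ^+ 2) //; ring: s2.
Qed.

(** If s b = -1, applying S gives s S(b) = -1; the product of the two reads 2 = 1. *)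
Lemma allpass_shift_neq0 (b : F) : b * S b = 1 -> 1 + s * b != 0.
Proof.
move=> bSb; apply/eqP => sb; have sSb : 1 + s * S b = 0.
  by rewrite -[in s * _]Ss -rmorphM -(rmorph1 S) -rmorphD sb rmorph0.
have sb1 : s * b = -1 by apply/eqP; rewrite -addr_eq0 addrC sb.
have sSb1 : s * S b = -1 by apply/eqP; rewrite -addr_eq0 addrC sSb.
have /eqP : (s * b) * (s * S b) = 1 by rewrite sb1 sSb1 mulrNN mulr1.
rewrite mulrACA bSb mulr1 -expr2 s2 -subr_eq0 -[2]/(1 + 1) addrK.
by rewrite oner_eq0.
Qed.

Lemma filter_ofE (b : F) : b * S b = 1 ->
  filter_of b = b * (s + b) / (b ^+ 2 + s * b + 1).
Proof.
move=> /allpass_shift_neq0 sb; rewrite /filter_of.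
have t0 := trinomial_neq0 b.
have -> : 1 + 1 / (1 + s * b) ^+ 2 =
    2 * (b ^+ 2 + s * b + 1) / (1 + s * b) ^+ 2.
  by field: s2.
have -> : 1 - 1 / (1 + s * b) ^+ 2 = 2 * (b * (s + b)) / (1 + s * b) ^+ 2.
  by field: s2.
by field; rewrite sb t0 two0.
Qed.

Lemma rmorph_filter_of (b : F) : S (filter_of b) = filter_of (S b).
Proof.
by rewrite /filter_of !(rmorphM, rmorphB, rmorphD, rmorph1, fmorphV, rmorphXn) Ss.
Qed.

(** S replaces b by 1/b; the trinomial is palindromic, so clearing b^2 leaves the denominator
    unchanged. *)
Lemma S_filter_ofE (b : F) : b * S b = 1 ->
  S (filter_of b) = (1 + s * b) / (b ^+ 2 + s * b + 1).
Proof.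
move=> bSb; have b0 : b != 0.
  by apply: contra_eq_neq bSb => ->; rewrite mul0r eq_sym oner_eq0.
have Sb : S b = b^-1 by apply: (mulfI b0); rewrite bSb divff.
rewrite rmorph_filter_of filter_ofE ?SK 1?mulrC // Sb.
have := trinomial_neq0 b; have := trinomial_neq0 b^-1 => t1 t0.
by field; rewrite b0 t0.
Qed.

Lemma filter_of_pythagoras (b : F) : b * S b = 1 ->
  filter_of b ^+ 2 + S (filter_of b) ^+ 2 = 1.
Proof.
move=> bSb; rewrite S_filter_ofE // filter_ofE //.
by have t0 := trinomial_neq0 b; field: s2.
Qed.

Lemma filter_ofK (b : F) : b * S b = 1 -> allpass_of (filter_of b) = b.
Proof.
move=> bSb; rewrite /allpass_of S_filter_ofE // filter_ofE //.
have t0 := trinomial_neq0 b; have u0 := allpass_shift_neq0 _ bSb.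
by field: s2; rewrite t0 u0 s0.
Qed.

Lemma pythagoras_neq0 (H : F) : H ^+ 2 + S H ^+ 2 = 1 -> H != 0.
Proof.
apply: contra_eq_neq => ->; rewrite rmorph0 expr0n addr0 eq_sym.
exact: oner_neq0.
Qed.

Lemma pythagoras_S (H : F) : H ^+ 2 + S H ^+ 2 = 1 ->
  S H ^+ 2 + S (S H) ^+ 2 = 1.
Proof. by rewrite SK addrC. Qed.

(** With K = S(H), the numerators multiply to 1 - (H - K)^2 = 2 H K, which is the product s^2 H K of
    the denominators. *)
Lemma allpass_ofP (H : F) : H ^+ 2 + S H ^+ 2 = 1 ->
  allpass_of H * S (allpass_of H) = 1.
Proof.
move=> HS; have H0 := pythagoras_neq0 _ HS.
have K0 := pythagoras_neq0 _ (pythagoras_S _ HS).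
rewrite /allpass_of !(rmorphM, rmorphB, rmorphD, rmorph1, fmorphV) Ss SK.
have K2 : S H ^+ 2 = 1 - H ^+ 2 by rewrite -HS addrC addKr.
by field: s2 K2; rewrite H0 K0 s0.
Qed.

(** For b = [allpass_of H], 1 + s b = (1 + H) / S(H) has square (1 + H) / (1 - H). Its inverse is
    the Cayley transform of H, and a second Cayley transform returns H. *)
Lemma allpass_ofK (H : F) : H ^+ 2 + S H ^+ 2 = 1 ->
  filter_of (allpass_of H) = H.
Proof.
move=> HS; have H0 := pythagoras_neq0 _ HS.
have K0 := pythagoras_neq0 _ (pythagoras_S _ HS).
(* The value H = -1 is fixed by S, so the hypothesis would read 1 + 1 = 1. *)
have H1 : 1 + H != 0.
  apply/eqP => H1; have HN1 : H = -1 by apply/eqP; rewrite -addr_eq0 addrC H1.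
  have /eqP := HS; rewrite HN1 rmorphN rmorph1 sqrrN expr1n.
  by rewrite -subr_eq0 addrK oner_eq0.
have K2 : S H ^+ 2 = (1 - H) * (1 + H).
  by rewrite -subr_sqr expr1n -HS addrC addKr.
rewrite /filter_of; have -> : 1 + s * allpass_of H = (1 + H) / S H.
  by rewrite /allpass_of; field; rewrite s0 K0.
rewrite expr_div_n K2 expr2.
have -> : 1 / ((1 + H) * (1 + H) / ((1 - H) * (1 + H))) = (1 - H) / (1 + H).
  have H1' : 1 - H != 0.
    by apply: contra_neq K0 => H1'; apply/eqP; rewrite -sqrf_eq0 K2 H1' mul0r.
  by field; rewrite H1 H1'.
exact: cayleyK two0 H1.
Qed.

(** Clearing y^2 in [filter_ofE]: the sign e disappears from the squares and survives only on the
    cross terms. *)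
Lemma filter_of_ratio (e x y : F) : e ^+ 2 = 1 -> y != 0 ->
  e * x / y * S (e * x / y) = 1 ->
  filter_of (e * x / y) =
    x * (x + e * s * y) / (x ^+ 2 + y ^+ 2 + e * s * x * y) /\
  x ^+ 2 + y ^+ 2 + e * s * x * y != 0.
Proof.
move=> e2 y0 bSb; rewrite filter_ofE //.
have tE : (e * x / y) ^+ 2 + s * (e * x / y) + 1 =
    (x ^+ 2 + y ^+ 2 + e * s * x * y) / y ^+ 2 by field: e2.
have D0 : x ^+ 2 + y ^+ 2 + e * s * x * y != 0.
  have := trinomial_neq0 (e * x / y).
  by rewrite tE mulf_eq0 negb_or => /andP[].
by split=> //; rewrite tE; field: e2; rewrite D0 y0.
Qed.

End Correspondence.

(** * Polynomials under z -> -z and coefficient reversal *)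

Section Reflection.
Variable F : fieldType.
Implicit Types p q : {poly F}.

Local Notation refl p := (p \Po - 'X).

Lemma comp_polyNXK p : refl (refl p) = p.
Proof. by rewrite -comp_polyA rmorphN /= comp_polyX opprK comp_polyXr. Qed.

Lemma size_comp_polyNX p : size (refl p) = size p.
Proof. by rewrite size_comp_poly2 // size_polyN size_polyX. Qed.

Lemma comp_polyNX_eq0 p : (refl p == 0) = (p == 0).
Proof. by rewrite -!size_poly_eq0 size_comp_polyNX. Qed.

(** By coprimality p divides q(-z) and q divides p(-z); reflecting the first relation shows that q
    and p(-z) are associated. Substituting q = c p(-z) back and cancelling gives c^2 = 1. *)
Lemma reflection_quotient p q : coprimep p q -> p != 0 ->
  p * refl p = q * refl q -> exists2 c : F, c ^+ 2 = 1 & q = c *: refl p.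
Proof.
move=> cpq p0 E.
have pq : p %| refl q by rewrite -(Gauss_dvdpr _ cpq) -E dvdp_mulr.
have qp : q %| refl p.
  by rewrite coprimep_sym in cpq; rewrite -(Gauss_dvdpr _ cpq) E dvdp_mulr.
have pq' : refl p %| q by rewrite -[q]comp_polyNXK dvdp_comp_poly.
have /eqpf_eq [c _ qE] : q %= refl p by rewrite /eqp qp pq'.
exists c => //; apply/eqP; move/eqP: E.
rewrite qE linearZ /= comp_polyNXK -scalerAl -scalerAr scalerA [refl p * p]mulrC.
rewrite -subr_eq0 -[X in X - _]scale1r -scalerBl scaler_eq0 mulf_eq0.
by rewrite comp_polyNX_eq0 (negPf p0) !orbF subr_eq0 eq_sym expr2.
Qed.

(** The polynomial z^d p(1/z) with d = deg p; its degree is below d when p(0) = 0. *)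
Definition revp p : {poly F} := \poly_(i < size p) p`_((size p).-1 - i).

Lemma horner1_revp p : (revp p).[1] = p.[1].
Proof.
rewrite horner_poly horner_coef (reindex_inj rev_ord_inj) /=.
apply: eq_bigr => i _; rewrite !expr1n !mulr1 subnS predn_sub subKn //.
by rewrite -ltnS prednK // (leq_ltn_trans _ (ltn_ord i)).
Qed.

Lemma coef0_revp p : (revp p)`_0 = lead_coef p.
Proof.
rewrite coef_poly subn0 lead_coefE; case: ltnP => //.
by move=> sp; rewrite nth_default // (leq_trans sp).
Qed.

(** The last hypothesis is the invariance of p(z)/p(-z) under z -> 1/z with denominators cleared. *)
Lemma coprime_revp p : coprimep p (refl p) -> p.[1] != 0 -> 2 != 0 :> F ->
  revp p * refl p = p * revp (refl p) ->
  [/\ revp p = p, p.[0] != 0 & ~~ odd (size p).-1].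
Proof.
move=> cp p1 two0 E.
have p0 : p != 0 by apply: contraNneq p1 => ->; rewrite horner0.
have pr : p %| revp p by rewrite -(Gauss_dvdpl _ cp) E dvdp_mulr.
have r0 : revp p != 0.
  by apply: contraNneq p1 => r0; rewrite -horner1_revp r0 horner0.
(* The reversal is no longer than p, so divisibility by p makes them proportional. *)
have /eqpf_eq [c _ rE] : revp p %= p.
  by rewrite eqp_sym -dvdp_size_eqp // eqn_leq dvdp_leq //= size_poly.
have c1 : c = 1.
  apply: (mulIf p1); rewrite mul1r -[in RHS]horner1_revp rE.
  by rewrite hornerZ.
have {c c1} rE : revp p = p by rewrite rE c1 scale1r.
have lead0 : p.[0] = lead_coef p by rewrite -[in LHS]rE horner_coef0 coef0_revp.
have pz : p.[0] != 0 by rewrite lead0 lead_coef_eq0.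
(* Cancelling p shows that p(-z) is its own reversal too. Its constant term is p(0), the leading
   coefficient of p, while its own leading coefficient carries the sign (-1)^d; an odd d would force
   twice the leading coefficient to vanish. *)
split=> //; move: E; rewrite rE => /(mulfI p0) E.
have : (refl p).[0] = lead_coef (refl p).
  by rewrite {1}E horner_coef0 coef0_revp.
rewrite horner_comp !hornerE oppr0 lead0 lead_coef_comp ?size_polyN ?size_polyX //.
rewrite lead_coefN lead_coefX -signr_odd; case: odd => //= /eqP.
rewrite expr1 mulrN1 -addr_eq0 -mulr2n -mulr_natr mulf_eq0 (negPf two0) orbF.
by rewrite lead_coef_eq0 (negPf p0).
Qed.

End Reflection.

(** * The bijections and the normal form over R(z) *)

Section Main.
Variable R : realType.
Implicit Types (a b H : ratfun R) (A : {poly R}).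

Local Notation z := (zz R).
Local Notation s := (rf (Num.sqrt 2)%:P : ratfun R).
Local Notation S := (sub_negz R).
Local Notation T := (sub_invz R).
Local Notation B := (sub_beta R).

Let s2 : s ^+ 2 = 2.
Proof.
by rewrite /rf -!rmorphXn /= sqr_sqrtr ?ler0n // !rmorph_nat.
Qed.

Let Ss : S s = s. Proof. exact: subst_cst. Qed.
Let Tc c : T (rf c%:P) = rf c%:P. Proof. exact: subst_cst. Qed.
Let Ts : T s = s. Proof. exact: Tc. Qed.
Let Bs : B s = s. Proof. exact: subst_cst. Qed.
Let SK f : S (S f) = f. Proof. exact: fcomp_negzK. Qed.
Let BK f : B (B f) = f. Proof. exact: fcomp_betaK. Qed.
Let SB f : S (B f) = B (T f). Proof. exact: fcomp_beta_negz. Qed.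
Let TB f : T (B f) = B (S f). Proof. exact: fcomp_beta_invz. Qed.
Let TS f : T (S f) = S (T f). Proof. by symmetry; exact: fcomp_invz_negz. Qed.

Let PhiE a : Phi a = filter_of _ s (B a). Proof. by []. Qed.

Let PsiE H : Psi H = B (allpass_of _ s S H).
Proof.
rewrite /Psi fcomp_Nbeta /allpass_of fmorph_div rmorphB rmorphD rmorph1 rmorphM.
by rewrite Bs.
Qed.

Let sqrN1 := @one_add_sqr_neq0 R.
Let two0 := two_neq0 R.

(** Conjugation by B turns the all-pass condition, stated with T, into one on S, and evenness into
    invariance under T. *)
Lemma even_allpass_beta a :
  even_allpass a -> B a * S (B a) = 1 /\ T (B a) = B a.
Proof.
by case=> aTa Sa; rewrite SB TB -rmorphM [a * T a]aTa rmorph1 [S a]Sa.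
Qed.

Lemma zero_sym_allpass H : zero_sym H ->
  let b := allpass_of _ s S H in b * S b = 1 /\ T b = b.
Proof.
case=> HS TH b; split; first exact: (allpass_ofP _ _ _ s2 two0 Ss SK).
rewrite /b /allpass_of fmorph_div rmorphB rmorphD rmorph1 rmorphM.
by rewrite TS Ts [T H]TH.
Qed.

Lemma Phi_zero_sym a : even_allpass a -> zero_sym (Phi a).
Proof.
move=> /even_allpass_beta [bSb Tb]; rewrite PhiE; split.
  exact: (filter_of_pythagoras _ _ _ s2 two0 sqrN1 Ss SK).
by rewrite -[fcomp _ _]/(T _) rmorph_filter_of // Tb.
Qed.

Lemma Psi_even_allpass H : zero_sym H -> even_allpass (Psi H).
Proof.
move=> /zero_sym_allpass [bSb Tb]; rewrite PsiE; split.
  by rewrite -[fcomp _ _]/(T _) TB -rmorphM bSb rmorph1.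
by rewrite -[fcomp _ _]/(S _) SB Tb.
Qed.

Lemma PhiK a : even_allpass a -> Psi (Phi a) = a.
Proof.
move=> /even_allpass_beta [bSb _]; rewrite PsiE PhiE.
by rewrite (filter_ofK _ _ _ s2 two0 sqrN1 Ss SK) ?BK.
Qed.

Lemma PsiK H : zero_sym H -> Phi (Psi H) = H.
Proof.
by case=> HS _; rewrite PhiE PsiE BK (allpass_ofK _ _ _ s2 two0 SK).
Qed.

Let S_rf A : S (rf A) = rf (A \Po - 'X).
Proof.
rewrite -peval_rf -[LHS]/(fcomp _ _) (fcomp_rf _ _ _ (transcendental_negz R)).
by rewrite /rf rmorphN.
Qed.

Let z0 : z != 0 := transcendental_neq0 _ _ (transcendental_zz R).

Lemma mul_invz_rf A : z ^+ (size A).-1 * T (rf A) = rf (revp _ A).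
Proof.
rewrite -[T _]/(fcomp _ _) (fcomp_rf _ _ _ (transcendental_invz R)) pevalE.
rewrite horner_coef size_map_inj_poly; last 2 first.
- exact: (inj_comp (@rf_inj R) (@polyC_inj R)).
- exact: rmorph0.
(* Reversing the summation index matches the terms, because z^d z^-(d-i) = z^i. *)
rewrite /revp poly_def /rf rmorph_sum mulr_sumr (reindex_inj rev_ord_inj) /=.
apply: eq_bigr => i _; rewrite subnS predn_sub coef_map /=.
have iA : (i <= (size A).-1)%N.
  by rewrite -ltnS prednK // (leq_ltn_trans _ (ltn_ord i)).
by rewrite -mul_polyC rmorphM rmorphXn mulrCA (mul_exprV_sub _ _ _ _ z0 iA).
Qed.

(** The last conjunct records T b = b in the polynomial form expected by [coprime_revp]. *)
Lemma zero_sym_factorization H : zero_sym H ->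
  exists (c : R) A, [/\ c ^+ 2 = 1, coprimep A (A \Po - 'X),
    rf A ^+ 2 + rf (A \Po - 'X) ^+ 2 + rf c%:P * s * rf A * rf (A \Po - 'X) != 0,
    H = rf A * (rf A + rf c%:P * s * rf (A \Po - 'X)) /
      (rf A ^+ 2 + rf (A \Po - 'X) ^+ 2 + rf c%:P * s * rf A * rf (A \Po - 'X)) &
    revp _ A * (A \Po - 'X) = A * revp _ (A \Po - 'X)].
Proof.
move=> H01; have [HS _] := H01; have [] := zero_sym_allpass H H01.
have := allpass_ofK _ _ _ s2 two0 SK _ HS.
set b := allpass_of _ _ _ _ => bH bSb Tb.
have [A [Q [cAQ Q0 bE]]] := ratfun_coprime _ b.
have b0 : b != 0.
  by apply: contra_eq_neq bSb => ->; rewrite mul0r eq_sym oner_eq0.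
have A0 : A != 0 by apply: contra_neq b0 => A0; rewrite bE A0 /rf rmorph0 mul0r.
have r0 : A \Po - 'X != 0 by rewrite comp_polyNX_eq0.
have Q'0 : Q * (Q \Po - 'X) != 0 by rewrite mulf_neq0 ?comp_polyNX_eq0.
(* This is b S(b) = 1 read on numerators and denominators. *)
have AQ : A * (A \Po - 'X) = Q * (Q \Po - 'X).
  apply: rf_inj; move: bSb; rewrite bE fmorph_div !S_rf mulf_div.
  rewrite -[rf A * _](rmorphM (@FracField.tofrac {poly R})).
  rewrite -[rf Q * _](rmorphM (@FracField.tofrac {poly R})).
  exact: divr1_eq.
have [c c2 QE] := reflection_quotient _ _ _ cAQ A0 AQ.
have c0 : c != 0 by rewrite -sqrf_eq0 c2 oner_eq0.
have e2 : rf c%:P ^+ 2 = 1 by rewrite /rf -!rmorphXn c2 !rmorph1.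
have e0 : rf c%:P != 0 by apply: rf_neq0; rewrite polyC_eq0.
have y0 := rf_neq0 _ _ r0.
(* As 1/c = c, the constant moves from the denominator to the numerator. *)
have {}bE : b = rf c%:P * rf A / rf (A \Po - 'X).
  rewrite bE QE -mul_polyC [rf (_ * _)]rmorphM.
  exact: div_sqr1.
exists c, A; have [] := filter_of_ratio _ _ _ s2 two0 sqrN1 Ss _ (rf A) _ e2 y0.
  by rewrite -bE.
rewrite -bE bH => HE D0; split=> [||//||].
- exact: c2.
- by rewrite QE coprimepZr in cAQ.
- exact: HE.
(* This is T b = b with the denominators cleared and c cancelled. *)
have E : T (rf A) * rf (A \Po - 'X) = rf A * T (rf (A \Po - 'X)).
  apply: (eq_scaled_ratio _ (rf c%:P) _ _ _ _ e0 y0).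
    by rewrite fmorph_eq0; exact: y0.
  by rewrite -bE -Tb bE fmorph_div rmorphM Tc.
apply: rf_inj; rewrite [LHS]rmorphM [RHS]rmorphM.
rewrite -[RHS]/(rf A * rf (revp _ (A \Po - 'X))).
rewrite -[LHS]/(rf (revp _ A) * rf (A \Po - 'X)).
(* A and A(-z) have the same size, so one power of z serves both reversals. *)
by rewrite -!mul_invz_rf size_comp_polyNX -mulrA E mulrCA.
Qed.

(** Denominator minus numerator is A(-z)^2, and H(1) = 1 makes this difference vanish at 1. *)
Lemma factorization_root H (c : R) A : rf_value H 1 1 -> c ^+ 2 = 1 ->
  rf A ^+ 2 + rf (A \Po - 'X) ^+ 2 + rf c%:P * s * rf A * rf (A \Po - 'X) != 0 ->
  H = rf A * (rf A + rf c%:P * s * rf (A \Po - 'X)) /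
    (rf A ^+ 2 + rf (A \Po - 'X) ^+ 2 + rf c%:P * s * rf A * rf (A \Po - 'X)) ->
  A.[-1] = 0.
Proof.
move=> [p [q [q1 HE pq1]]] c2.
set N := A * (A + c%:P * (Num.sqrt 2)%:P * (A \Po - 'X)).
set D := A ^+ 2 + (A \Po - 'X) ^+ 2 + c%:P * (Num.sqrt 2)%:P * A * (A \Po - 'X).
have -> : rf A ^+ 2 + rf (A \Po - 'X) ^+ 2 +
    rf c%:P * s * rf A * rf (A \Po - 'X) = rf D.
  by rewrite /rf !(rmorphM, rmorphD, rmorphXn).
have -> : rf A * (rf A + rf c%:P * s * rf (A \Po - 'X)) = rf N.
  by rewrite /rf !(rmorphM, rmorphD, rmorphXn).
move=> D0; rewrite HE => /eqP; have q0 : q != 0.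
  by apply: contraNneq q1 => ->; rewrite horner0.
(* Cross-multiplying to a polynomial identity first makes evaluation at 1 safe, whatever the value
   of D there. *)
rewrite (eqr_div _ _ (rf_neq0 _ _ q0) D0) /rf -!rmorphM tofrac_eq => /eqP.
move=> /(congr1 (horner^~ 1)); rewrite (hornerM p) (hornerM N).
have -> : p.[1] = q.[1] by rewrite -[p.[1]](divfK q1) pq1 mul1r.
rewrite [N.[1] * _]mulrC => /(mulfI q1).
rewrite /N /D !(hornerE, horner_comp) => /eqP; rewrite -subr_eq0 => /eqP E.
by apply/eqP; rewrite -sqrf_eq0; apply/eqP; rewrite -[RHS]E; ring.
Qed.

Lemma zero_sym_normal_form H : zero_sym H -> rf_value H 1 1 ->
  exists (eps : R) A,
    (eps = 1 \/ eps = -1) /\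
    H = rf A * (rf A + rf (eps * Num.sqrt 2)%:P * rf (A \Po - 'X)) /
      (rf A ^+ 2 + rf (A \Po - 'X) ^+ 2
       + rf (eps * Num.sqrt 2)%:P * rf A * rf (A \Po - 'X)) /\
    ~~ odd (size A).-1 /\ coprimep A (A \Po - 'X) /\
    reciprocal A = rf A /\ A.[0] * A.[1] != 0 /\ A.[-1] = 0.
Proof.
move=> H01 H1.
have [c [A [c2 cA D0 HE rA]]] := zero_sym_factorization _ H01.
have AN1 := factorization_root _ _ _ H1 c2 D0 HE.
have A1 : A.[1] != 0.
  apply/negP => rA1; suff : root (A \Po - 'X) 1.
    by apply/negP; exact: coprimep_root cA rA1.
  by rewrite /root horner_comp !hornerE AN1.
have [rAE A0 evA] := coprime_revp _ _ cA A1 (lt0r_neq0 (ltr0n _ 2)) rA.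
exists c, A; rewrite [reciprocal A]mul_invz_rf rAE mulf_neq0 // AN1; split.
  by move/eqP: c2; rewrite sqrf_eq1 => /orP[] /eqP ->; [left | right].
by split; first by rewrite polyCM [rf (_ * _)]rmorphM.
Qed.

End Main.

Theorem theorem1 (R : realType) :
  [/\ (forall a : ratfun R, even_allpass a -> zero_sym (Phi a)),
      (forall H : ratfun R, zero_sym H -> even_allpass (Psi H)),
      (forall a : ratfun R, even_allpass a -> Psi (Phi a) = a),
      (forall H : ratfun R, zero_sym H -> Phi (Psi H) = H) &
      (forall H : ratfun R, zero_sym H -> rf_value H 1 1 ->
        exists (eps : R) (A : {poly R}),
          (eps = 1 \/ eps = -1) /\
              H = rf A * (rf A + rf (eps * Num.sqrt 2)%:P * rf (A \Po - 'X)) /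
                  (rf A ^+ 2 + rf (A \Po - 'X) ^+ 2
                   + rf (eps * Num.sqrt 2)%:P * rf A * rf (A \Po - 'X)) /\
              ~~ odd (size A).-1 /\
              coprimep A (A \Po - 'X) /\
              reciprocal A = rf A /\
              A.[0] * A.[1] != 0 /\
              A.[-1] = 0) ].
Proof.
split.
- exact: Phi_zero_sym.
- exact: Psi_even_allpass.
- exact: PhiK.
- exact: PsiK.
- exact: zero_sym_normal_form.
Qed.
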